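(* Let $\phi:\mathbb{R}^n\to\mathbb{R}$ be continuously differentiable with $L_1$-Lipschitz gradient, and bounded below on $\mathbb{R}^n$ by a scalar $\hat\phi$. Run Algorithm 1 (described in the context) with the bounded-noise zeroth-order oracle with constant $\epsilon_f\ge 0$, with the first-order oracle with constants $\epsilon_g,\kappa_{\rm eg}\ge 0$ and reliability $p_1\in(1/2,1]$, with $\|H_k\|\le\kappa_{\rm bhm}$ for all $k$, and with $r\ge 2\epsilon_f$. Let $C_1,C_2,C_3$ be the constants defined in the context, and let $$\epsilon>\sqrt{\frac{4\epsilon_f+2r}{C_3\gamma^2C_1^2(2p_1-1)}}+\frac{C_2}{C_1}\epsilon_g .$$ Then $$\mathbb{P}\Big\{\min_{0\le k\le T-1}\|\nabla\phi(X_k)\|\le\epsilon\Big\}\ \ge\ 1-\exp\Big(-\frac{(1-\hat p_1/p_1)^2}{2}T\Big)$$ for every $\hat p_1\in\Big(\frac12+\frac{2\epsilon_f+r}{C_3\gamma^2(C_1\epsilon-C_2\epsilon_g)^2},\,p_1\Big]$ and every positive integer $$T\ \ge\ \Big(\hat p_1-\frac12-\frac{2\epsilon_f+r}{C_3\gamma^2(C_1\epsilon-C_2\epsilon_g)^2}\Big)^{-1}\Big[\frac{\phi(x_0)-\hat\phi}{C_3\gamma^2(C_1\epsilon-C_2\epsilon_g)^2}+\frac12\log_\gamma\Big(\min\Big\{\frac{C_1\epsilon-C_2\epsilon_g}{\delta_0},\frac{\delta_0}{C_1\|\nabla\phi(x_0)\|-C_2\epsilon_g}\Big\}\Big)+\frac12\Big],$$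 where the second entry of the inner minimum is read as $+\infty$ if $C_1\|\nabla\phi(x_0)\|-C_2\epsilon_g\le 0$.
   Context: Notation: $\|\cdot\|$ is the Euclidean norm of vectors and the spectral norm of matrices; $\langle\cdot,\cdot\rangle$ is the sum of entrywise products; $\log_\gamma$ is the logarithm to base $\gamma\in(0,1)$. Bounded-noise zeroth-order oracle: given $x\in\mathbb{R}^n$ it returns a (possibly random or adversarial) value $f(x,\xi^{(0)})$ with $|f(x,\xi^{(0)})-\phi(x)|\le\epsilon_f$ for all realizations. First-order oracle: given $\delta^{(1)}>0$, $p_1\in[1/2,1]$ and $x\in\mathbb{R}^n$ it returns a random vector $g(x,\xi^{(1)})$ with $\mathbb{P}_{\xi^{(1)}}\{\|g(x,\xi^{(1)})-\nabla\phi(x)\|\le\epsilon_g+\kappa_{\rm eg}\delta^{(1)}\}\ge p_1$. The constants $\epsilon_g,\kappa_{\rm eg}\ge0$ are intrinsic to the oracle. Algorithm 1. Inputs: $x_0\in\mathbb{R}^n$, $\delta_0>0$, $\eta_1\in(0,1)$, $\eta_2>0$, $\gamma\in(0,1)$, $r>0$, $p_1$; constants $\kappa_{\rm fcd}\in(0,1]$, $\kappa_{\rm bhm}>0$. For $k=0,1,2,\dots$: (1) Obtain $g_k$ from the first-order oracle with input $(\delta_k,p_1,x_k)$, and a symmetric matrix $H_k$ with $\|H_k\|\le\kappa_{\rm bhm}$; put $m_k(x_k+s)=\phi(x_k)+\langle g_k,s\rangle+\frac12\langle H_ks,s\rangle$. (2) Compute $s_k$ with $\|s_k\|\le\delta_k$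 and $m_k(x_k)-m_k(x_k+s_k)\ge\frac{\kappa_{\rm fcd}}{2}\|g_k\|\min\{\|g_k\|/\|H_k\|,\delta_k\}$ (with $\|g_k\|/\|H_k\|=+\infty$ if $H_k=0$). (3) Obtain $f_k$ and $f_k^+$ from the zeroth-order oracle at $x_k$ and $x_k+s_k$, and set $\rho_k=\frac{f_k-f_k^++r}{m_k(x_k)-m_k(x_k+s_k)}$. (4) If $\rho_k\ge\eta_1$: set $x_{k+1}=x_k+s_k$ and $\delta_{k+1}=\gamma^{-1}\delta_k$ if $\|g_k\|\ge\eta_2\delta_k$, $\delta_{k+1}=\gamma\delta_k$ if $\|g_k\|<\eta_2\delta_k$. Otherwise set $x_{k+1}=x_k$, $\delta_{k+1}=\gamma\delta_k$. If $m_k(x_k)=m_k(x_k+s_k)$, the step is rejected (treated as $\rho_k<\eta_1$). Stochastic process: $X_k$, $\Delta_k$ denote the random iterates and radii with realizations $x_k,\delta_k$. The oracle guarantees hold conditionally on the past: with $\mathcal{F}_{k-1}$ the $\sigma$-algebra generated by all oracle randomness in iterations $0,\dots,k-1$ (so $X_k,\Delta_k$ are $\mathcal{F}_{k-1}$-measurable), the random model gradient $G_k$ (realization $g_k$) satisfies $\mathbb{P}\{\|G_k-\nabla\phi(X_k)\|\le\kappa_{\rm eg}\Delta_k+\epsilon_g\mid\mathcal{F}_{k-1}\}\ge p_1$. Constants: $$C_1=\min\Big\{\frac{(1-\eta_1)\kappa_{\rm fcd}}{L_1+\kappa_{\rm bhm}+2\kappa_{\rm eg}+(1-\eta_1)\kappa_{\rm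 fcd}\kappa_{\rm eg}},\frac{1}{\kappa_{\rm eg}+\eta_2}\Big\},$$ $$C_2=\max\Big\{\frac{(1-\eta_1)\kappa_{\rm fcd}+2}{L_1+\kappa_{\rm bhm}+2\kappa_{\rm eg}+(1-\eta_1)\kappa_{\rm fcd}\kappa_{\rm eg}},\frac{1}{\kappa_{\rm eg}+\eta_2}\Big\},\qquad C_3=\frac12\eta_1\eta_2\kappa_{\rm fcd}\min\Big\{\frac{\eta_2}{\kappa_{\rm bhm}},1\Big\}.$$ *)

(* Defs.v *)
From HB Require Import structures.
From mathcomp Require Import all_boot all_order all_algebra.
From mathcomp Require Import all_classical all_reals all_analysis.

Set Implicit Arguments.
Unset Strict Implicit.
Unset Printing Implicit Defensive.

Import Order.TTheory GRing.Theory Num.Theory.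
Import numFieldNormedType.Exports.

Local Open Scope classical_set_scope.
Local Open Scope ring_scope.

Section LinearAlgebra.
Context {R : realType}.

Definition dotmx m n (A B : 'M[R]_(m, n)) : R := \sum_i \sum_j A i j * B i j.

(* The library norm `|x| on matrices is the sup norm, whence this definition. *)
Definition enorm n (x : 'cV[R]_n) : R := Num.sqrt (dotmx x x).

Definition spectral_norm m n (A : 'M[R]_(m, n)) : R :=
  sup [set enorm (A *m v) | v in [set v : 'cV[R]_n | enorm v <= 1]].

End LinearAlgebra.

Section Smoothness.
Context {R : realType} {n : nat}.

Definition gradient (phi : 'cV[R]_n -> R) (x : 'cV[R]_n) : 'cV[R]_n :=
  \col_i 'D_(delta_mx i 0) phi x.

(* The library topology on 'cV[R]_n (sup norm) is the Euclidean one. *)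
Definition continuously_differentiable (phi : 'cV[R]_n -> R) : Prop :=
  (forall x, differentiable phi x) /\
  (forall x : 'cV[R]_n, {for x, continuous (gradient phi)}).

Definition lipschitz_gradient (phi : 'cV[R]_n -> R) (L1 : R) : Prop :=
  forall x y, enorm (gradient phi x - gradient phi y) <= L1 * enorm (x - y).

End Smoothness.

Section ConditionalProbability.
Context {d : measure_display} {Omega : measurableType d} {R : realType}.

(* [F] is meant to be a sub-sigma-algebra of the measurable sets of [Omega]. *)
Definition measurable_wrt (F : set_system Omega) (h : Omega -> R) : Prop :=
  preimage_set_system setT h measurable `<=` F.

Definition vmeasurable_wrt n (F : set_system Omega) (h : Omega -> 'cV[R]_n) :=
  forall i, measurable_wrt F (fun w => h w i 0).

(* [h] is a version of P(E | F). *)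
Definition cond_prob_version (P : probability Omega R) (F : set_system Omega)
    (E : set Omega) (h : Omega -> R) : Prop :=
  [/\ measurable_wrt F h,
      P.-integrable setT (EFin \o h) &
      forall A, F A -> (\int[P]_(w in A) (h w)%:E = P (A `&` E))%E].

(* P(E | F) >= p almost surely. *)
Definition cond_prob_ge (P : probability Omega R) (F : set_system Omega)
    (E : set Omega) (p : R) : Prop :=
  exists2 h, cond_prob_version P F E h & {ae P, forall w, p <= h w}.

End ConditionalProbability.

Section TrustRegion.
Context {R : realType} {n : nat}.

Record tr_params := TRParams {
  eta1 : R; eta2 : R; gamma : R; relax : R; kfcd : R; kbhm : R }.

Definition tr_params_ok (a : tr_params) : Prop :=
  [/\ 0 < eta1 a < 1, 0 < eta2 a, 0 < gamma a < 1, 0 < relax a &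
      (0 < kfcd a <= 1) /\ (0 < kbhm a)].

(* [model phi x g H s] is m(x + s). *)
Definition model (phi : 'cV[R]_n -> R) (x g : 'cV[R]_n) (H : 'M[R]_n)
    (s : 'cV[R]_n) : R :=
  phi x + dotmx g s + 2^-1 * dotmx (H *m s) s.

Definition model_decrease phi x g H s : R :=
  model phi x g H 0 - model phi x g H s.

(* min {|g| / |H|, delta}, the first entry being +oo if H = 0. *)
Definition cauchy_radius (g : 'cV[R]_n) (H : 'M[R]_n) (delta : R) : R :=
  if H == 0 then delta else Num.min (enorm g / spectral_norm H) delta.

Definition rho (a : tr_params) phi x g H s (f fp : R) : R :=
  (f - fp + relax a) / model_decrease phi x g H s.

Definition accepted (a : tr_params) phi x g H s (f fp : R) : bool :=
  (model phi x g H 0 != model phi x g H s) &&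
  (eta1 a <= rho a phi x g H s f fp).

(* A realization of the algorithm; [f k] and [fp k] are the zeroth-order oracle
   values at [x k] and [x k + s k]. *)
Record tr_trajectory (a : tr_params) (phi : 'cV[R]_n -> R)
    (x0 : 'cV[R]_n) (delta0 : R)
    (x : nat -> 'cV[R]_n) (delta : nat -> R) (g : nat -> 'cV[R]_n)
    (H : nat -> 'M[R]_n) (s : nat -> 'cV[R]_n) (f fp : nat -> R) : Prop := {
  tr_x0 : x 0%N = x0;
  tr_delta0 : delta 0%N = delta0;
  tr_H_sym : forall k, (H k)^T = H k;
  tr_H_bound : forall k, spectral_norm (H k) <= kbhm a;
  tr_s_bound : forall k, enorm (s k) <= delta k;
  tr_cauchy : forall k,
    model_decrease phi (x k) (g k) (H k) (s k) >=
    kfcd a / 2 * enorm (g k) * cauchy_radius (g k) (H k) (delta k);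
  tr_x_next : forall k, x k.+1 =
    if accepted a phi (x k) (g k) (H k) (s k) (f k) (fp k)
    then x k + s k else x k;
  tr_delta_next : forall k, delta k.+1 =
    if accepted a phi (x k) (g k) (H k) (s k) (f k) (fp k)
    then if eta2 a * delta k <= enorm (g k)
         then (gamma a)^-1 * delta k else gamma a * delta k
    else gamma a * delta k }.

Definition zeroth_order_oracle (Xi : Type) (phi : 'cV[R]_n -> R) (epsf : R)
    (f : 'cV[R]_n -> Xi -> R) : Prop :=
  forall x xi, `|f x xi - phi x| <= epsf.

End TrustRegion.
Arguments tr_params : clear implicits.

Section StochasticProcess.
Context {R : realType} {n : nat}.
Context {d d0 d1 : measure_display} {Omega : measurableType d}.
Context {Xi0 : measurableType d0} {Xi1 : measurableType d1}.

(* Randomness of the oracle calls of iteration k: [xi0 k] and [xi0p k] for the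
   zeroth-order oracle at X_k and X_k + S_k, [xi1 k] for the first-order one. *)
Record oracle_noise := OracleNoise {
  xi0 : nat -> Omega -> Xi0;
  xi0p : nat -> Omega -> Xi0;
  xi1 : nat -> Omega -> Xi1 }.

Definition noise_measurable (xi : oracle_noise) : Prop :=
  forall k, [/\ measurable_fun setT (xi0 xi k), measurable_fun setT (xi0p xi k)
              & measurable_fun setT (xi1 xi k)].

(* The sigma-algebra F_{k-1} generated by the oracle randomness in iterations
   0, ..., k-1; trivial for k = 0. *)
Definition history (xi : oracle_noise) (k : nat) : set_system Omega :=
  <<s \bigcup_(j in `I_k)
        (preimage_set_system setT (xi0 xi j) measurable `|`
         preimage_set_system setT (xi0p xi j) measurable `|`
         preimage_set_system setT (xi1 xi j) measurable) >>.

(* The first-order oracle [g] takes as inputs the radius, the reliability, the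
   point and the noise.  H_k and S_k are constrained only through the algorithm
   and the measurability of X_k and Delta_k. *)
Record tr_process (a : tr_params R) (phi : 'cV[R]_n -> R)
    (x0 : 'cV[R]_n) (delta0 p1 epsg keg : R)
    (f : 'cV[R]_n -> Xi0 -> R) (g : R -> R -> 'cV[R]_n -> Xi1 -> 'cV[R]_n)
    (P : probability Omega R) (xi : oracle_noise)
    (X : nat -> Omega -> 'cV[R]_n) (Delta : nat -> Omega -> R)
    (G : nat -> Omega -> 'cV[R]_n) (H : nat -> Omega -> 'M[R]_n)
    (S : nat -> Omega -> 'cV[R]_n) : Prop := {
  trp_noise : noise_measurable xi;
  trp_grad : forall k w, G k w = g (Delta k w) p1 (X k w) (xi1 xi k w);
  trp_run : forall w, tr_trajectory a phi x0 delta0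
    (X ^~ w) (Delta ^~ w) (G ^~ w) (H ^~ w) (S ^~ w)
    (fun k => f (X k w) (xi0 xi k w))
    (fun k => f (X k w + S k w) (xi0p xi k w));
  trp_X_meas : forall k, vmeasurable_wrt (history xi k) (X k);
  trp_Delta_meas : forall k, measurable_wrt (history xi k) (Delta k);
  trp_G_meas : forall k, vmeasurable_wrt (history xi k.+1) (G k);
  trp_reliable : forall k, cond_prob_ge P (history xi k)
    [set w | enorm (G k w - gradient phi (X k w)) <= keg * Delta k w + epsg]
    p1 }.

End StochasticProcess.
Arguments oracle_noise {d d0 d1} Omega Xi0 Xi1.

Section Constants.
Context {R : realType}.

Definition C1 (a : tr_params R) (L1 keg : R) : R :=
  Num.min ((1 - eta1 a) * kfcd a /
           (L1 + kbhm a + 2 * keg + (1 - eta1 a) * kfcd a * keg))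
          (1 / (keg + eta2 a)).

Definition C2 (a : tr_params R) (L1 keg : R) : R :=
  Num.max (((1 - eta1 a) * kfcd a + 2) /
           (L1 + kbhm a + 2 * keg + (1 - eta1 a) * kfcd a * keg))
          (1 / (keg + eta2 a)).

Definition C3 (a : tr_params R) : R :=
  2^-1 * eta1 a * eta2 a * kfcd a * Num.min (eta2 a / kbhm a) 1.

Definition logb (b x : R) : R := ln x / ln b.

(* min {u / delta0, delta0 / v}, the second entry being +oo if v <= 0. *)
Definition radius_ratio (delta0 u v : R) : R :=
  if v <= 0 then u / delta0 else Num.min (u / delta0) (delta0 / v).

End Constants.

(* Main.v *)
From Pilot Require Import Defs.
From HB Require Import structures.
From mathcomp Require Import all_boot all_order all_algebra.
From mathcomp Require Import all_classical all_reals all_analysis.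
From mathcomp Require Import measurable_realfun.
From mathcomp Require Import ring lra.

Set Implicit Arguments.
Unset Strict Implicit.
Unset Printing Implicit Defensive.

Import Order.TTheory GRing.Theory Num.Theory.
Import numFieldNormedType.Exports.
(* Restores the entrywise [dotmx], hidden by a sesquilinear form. *)
Import Pilot.Defs.

Local Open Scope classical_set_scope.
Local Open Scope ring_scope.

(** Call an iteration reliable if its model gradient is accurate, that is, if
    the event of the first-order oracle occurs, and write
    [D = C1 * eps - C2 * epsg] and [K = C3 * gamma ^+ 2 * D ^+ 2].  As long as
    every gradient exceeds [eps], a reliable iteration with radius at most [D]
    is accepted and enlarges the radius
    ([reliable_small_radius_success]), and an iteration that enlarges a radius
    larger than [gamma * D] decreases [phi] by at least [K], up to the error
    [2 * epsf + relax] that any iteration may add.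

    The radius is [B * gamma ^ (- z)] for an integer [z] moving by one at each
    iteration, where [gamma * D < B <= D], so that the sign of [z] compares the
    radius with [D].  The potential [phi / K + `|z| / 2] then grows by at most
    [1 / 2 + (2 * epsf + relax) / K] at each iteration, and by one less at a
    reliable one ([potential_step]).  Since [phi] is bounded below, summing over
    [T] iterations bounds the number of reliable ones ([reliable_count_le]); for
    [T] as large as assumed the bound is at most [phat * T].  This half of the
    proof is about a single realization.

    Probability enters only through the number of reliable iterations among
    the first [T].  Each one is reliable with conditional probability at least
    [p1] given the past, so the exponential moment of this number is at most
    that of a binomial variable ([count_moment_le]), and Markov's inequality
    gives a binomial tail ([count_tail_le]).  The rate
    [(1 - phat / p1) ^+ 2 / 2] is a Hoeffding bound, proved in
    [bernoulli_expR_le].  Measurability comes from the history: the count up to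
    iteration [k] is a function of the past because a continuous function of a
    coordinatewise measurable vector is measurable
    ([measurable_continuous_comp]). *)

(** * Euclidean and spectral norms *)

Section EuclideanNorm.
Context {R : realType}.

Lemma dotmxC m n (A B : 'M[R]_(m, n)) : dotmx A B = dotmx B A.
Proof. by apply: eq_bigr => i _; apply: eq_bigr => j _; rewrite mulrC. Qed.

Lemma dotmxDr m n (A B C : 'M[R]_(m, n)) :
  dotmx A (B + C) = dotmx A B + dotmx A C.
Proof.
rewrite /dotmx -big_split; apply: eq_bigr => i _.
by rewrite -big_split; apply: eq_bigr => j _; rewrite mxE mulrDr.
Qed.

Lemma dotmxZr m n c (A B : 'M[R]_(m, n)) : dotmx A (c *: B) = c * dotmx A B.
Proof.
rewrite /dotmx mulr_sumr; apply: eq_bigr => i _.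
by rewrite mulr_sumr; apply: eq_bigr => j _; rewrite mxE mulrCA.
Qed.

Lemma dotmxDl m n (A B C : 'M[R]_(m, n)) :
  dotmx (B + C) A = dotmx B A + dotmx C A.
Proof. by rewrite dotmxC dotmxDr !(dotmxC A). Qed.

Lemma dotmxZl m n c (A B : 'M[R]_(m, n)) : dotmx (c *: B) A = c * dotmx B A.
Proof. by rewrite dotmxC dotmxZr (dotmxC A). Qed.

Lemma dotmxNl m n (A B : 'M[R]_(m, n)) : dotmx (- B) A = - dotmx B A.
Proof. by rewrite -scaleN1r dotmxZl mulN1r. Qed.

Lemma dotmx0r m n (A : 'M[R]_(m, n)) : dotmx A 0 = 0.
Proof. by rewrite -(scale0r (0 : 'M[R]_(m, n))) dotmxZr mul0r. Qed.

Lemma dotmx_ge0 m n (A : 'M[R]_(m, n)) : 0 <= dotmx A A.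
Proof. by apply: sumr_ge0 => i _; apply: sumr_ge0 => j _; exact: sqr_ge0. Qed.

Lemma enorm_ge0 n (x : 'cV[R]_n) : 0 <= enorm x.
Proof. exact: sqrtr_ge0. Qed.

Lemma enorm_sqr n (x : 'cV[R]_n) : enorm x ^+ 2 = dotmx x x.
Proof. by rewrite sqr_sqrtr // dotmx_ge0. Qed.

Lemma enormZ n c (x : 'cV[R]_n) : enorm (c *: x) = `|c| * enorm x.
Proof.
by rewrite /enorm dotmxZr dotmxZl mulrA sqrtrM ?sqr_ge0 // -expr2 sqrtr_sqr.
Qed.

Lemma enormN n (x : 'cV[R]_n) : enorm (- x) = enorm x.
Proof. by rewrite -scaleN1r enormZ normrN1 mul1r. Qed.

(** Cauchy-Schwarz, from the nonnegative quadratic polynomial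
    [t |-> dotmx (x + t *: y) (x + t *: y)]; its minimizer is [- b / c] if
    [c != 0]. *)
Lemma dotmx_le_enorm n (x y : 'cV[R]_n) : dotmx x y <= enorm x * enorm y.
Proof.
have [xy0|xy0] := leP (dotmx x y) 0.
  by rewrite (le_trans xy0) // mulr_ge0 // enorm_ge0.
rewrite -ler_sqr ?nnegrE ?mulr_ge0 ?enorm_ge0 ?(ltW xy0) // exprMn !enorm_sqr.
set a := dotmx x x; set b := dotmx x y in xy0 *; set c := dotmx y y.
have quad t : 0 <= a + 2 * t * b + t ^+ 2 * c.
  have := dotmx_ge0 (x + t *: y).
  rewrite dotmxDl !dotmxDr !dotmxZl !dotmxZr (dotmxC y x) -/a -/b -/c.
  by congr (_ <= _); ring.
have c0 : 0 <= c by exact: dotmx_ge0.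
have a0 : 0 <= a by exact: dotmx_ge0.
have [c_eq0|c_neq0] := eqVneq c 0.
  (* The polynomial is affine: at this point its value is -1. *)
  have := quad (- (a + 1) / (2 * b)); rewrite c_eq0 mulr0 addr0.
  have -> : 2 * (- (a + 1) / (2 * b)) * b = - (a + 1) by field; rewrite gt_eqF.
  lra.
have c_gt0 : 0 < c by rewrite lt_neqAle eq_sym c_neq0.
have := quad (- b / c).
have -> : a + 2 * (- b / c) * b + (- b / c) ^+ 2 * c = a - b ^+ 2 / c.
  by field.
by rewrite subr_ge0 ler_pdivrMr.
Qed.

Lemma ler_enormD n (x y : 'cV[R]_n) : enorm (x + y) <= enorm x + enorm y.
Proof.
rewrite -ler_sqr ?nnegrE ?addr_ge0 ?enorm_ge0 // enorm_sqr dotmxDl !dotmxDr.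
rewrite (dotmxC y x) sqrrD -!enorm_sqr; have := dotmx_le_enorm x y; lra.
Qed.

Lemma enorm_eq0 n (x : 'cV[R]_n) : enorm x = 0 -> x = 0.
Proof.
move=> x0; have : dotmx x x = 0 by rewrite -enorm_sqr x0 expr0n.
move=> xx0; apply/matrixP => i j; rewrite mxE.
have inner_ge0 k : 0 <= \sum_j x k j * x k j.
  by apply: sumr_ge0 => l _; exact: sqr_ge0.
have xi0 : \sum_l x i l * x i l = 0.
  by apply: (psumr_eq0P _ xx0) => // k _; exact: inner_ge0.
have : x i j * x i j = 0.
  by apply: (psumr_eq0P _ xi0) => // l _; exact: sqr_ge0.
by move=> /eqP; rewrite mulf_eq0 orbb => /eqP.
Qed.

Lemma entry_le_enorm n (x : 'cV[R]_n) i : `|x i 0| <= enorm x.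
Proof.
rewrite -ler_sqr ?nnegrE ?enorm_ge0 // enorm_sqr real_normK ?num_real //.
rewrite /dotmx (bigD1 i) //= big_ord1 expr2 lerDl.
by apply: sumr_ge0 => k _; apply: sumr_ge0 => l _; exact: sqr_ge0.
Qed.

Lemma enorm_mulmx_bounded n (H : 'M[R]_n) :
  exists c, forall v : 'cV[R]_n, enorm (H *m v) <= c * enorm v.
Proof.
exists (Num.sqrt (\sum_i (\sum_j `|H i j|) ^+ 2)) => v.
have sum0 : 0 <= \sum_i (\sum_j `|H i j|) ^+ 2.
  by apply: sumr_ge0 => i _; exact: sqr_ge0.
rewrite -ler_sqr ?nnegrE ?mulr_ge0 ?enorm_ge0 ?sqrtr_ge0 //.
rewrite enorm_sqr exprMn sqr_sqrtr // mulr_suml; apply: ler_sum => i _.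
rewrite big_ord1 -expr2 -exprMn -[leLHS]real_normK ?num_real //.
rewrite ler_sqr ?nnegrE ?mulr_ge0 ?enorm_ge0 ?sumr_ge0 // mxE mulr_suml.
apply: le_trans (ler_norm_sum _ _ _) _; apply: ler_sum => j _.
by rewrite normrM ler_wpM2l // entry_le_enorm.
Qed.

(** Scaling to the unit ball needs the supremum defining the spectral norm to
    be that of a bounded set, since [sup] is a default value otherwise. *)
Lemma enorm_mulmx n (H : 'M[R]_n) (v : 'cV[R]_n) :
  enorm (H *m v) <= spectral_norm H * enorm v.
Proof.
have [c Hc] := enorm_mulmx_bounded H.
have [v0|v0] := eqVneq (enorm v) 0.
  by rewrite (enorm_eq0 v0) mulmx0 -(scale0r (0 : 'cV[R]_n)) enormZ normr0
    mul0r mulr0.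
have v_gt0 : 0 < enorm v by rewrite lt_neqAle eq_sym v0 enorm_ge0.
rewrite -ler_pdivrMr //; apply: ub_le_sup.
  exists `|c| => _ [u u1 <-]; apply: le_trans (Hc u) _.
  apply: (@le_trans _ _ (`|c| * enorm u)).
    by rewrite ler_wpM2r ?enorm_ge0 // ler_norm.
  by rewrite ler_piMr.
exists ((enorm v)^-1 *: v) => /=.
  by rewrite enormZ ger0_norm ?invr_ge0 ?enorm_ge0 // mulVf.
by rewrite -scalemxAr enormZ ger0_norm ?invr_ge0 ?enorm_ge0 // mulrC.
Qed.

Lemma spectral_norm_gt0 n (H : 'M[R]_n) : H != 0 -> 0 < spectral_norm H.
Proof.
apply: contra_neqT; rewrite -leNgt => H0; apply/matrixP => i j; rewrite mxE.
have /enorm_eq0 : enorm (H *m delta_mx j (0 : 'I_1)) = 0.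
  apply/eqP; rewrite eq_le enorm_ge0 andbT (le_trans (enorm_mulmx _ _)) //.
  by rewrite mulr_le0_ge0 // enorm_ge0.
by rewrite -colE => /matrixP/(_ i 0); rewrite !mxE.
Qed.

End EuclideanNorm.

(** * The descent lemma *)

Section Descent.
Context {R : realType}.

Lemma derive_le0_le (h dh : R -> R) (a b : R) : a <= b ->
  (forall t : R, is_derive t 1 h (dh t)) ->
  (forall t, a < t < b -> dh t <= 0) -> h b <= h a.
Proof.
move=> ab hdh dh0.
have drv t : derivable h t 1 by have [] := hdh t.
apply: (@ler0_derive1_le_cc _ h a b); rewrite ?in_itv /= ?lexx ?ab //.
  move=> t; rewrite in_itv /= => /dh0; rewrite derive1E.
  by have [_ ->] := hdh t.
apply: continuous_subspaceT => t; apply/differentiable_continuous.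
exact/derivable1_diffP.
Qed.

Context {n : nat}.
Implicit Types (phi : 'cV[R]_n -> R) (x s : 'cV[R]_n).

(** Differentiability makes the directional derivative linear in the direction,
    hence determined by the partial derivatives. *)
Lemma derive_gradient phi x s :
  differentiable phi x -> 'D_s phi x = dotmx (gradient phi x) s.
Proof.
move=> dphi; rewrite deriveE // [in LHS](matrix_sum_delta s) linear_sum.
apply: eq_bigr => i _; rewrite !big_ord1 linearZ /= mxE -deriveE //.
by rewrite mulrC.
Qed.

Lemma is_derive_line phi x s (t : R) : differentiable phi (x + t *: s) ->
  is_derive t 1 (fun u => phi (x + u *: s))
    (dotmx (gradient phi (x + t *: s)) s).
Proof.
move=> dphi.
have dq : (fun h : R => h^-1 *: (phi (x + (h *: 1 + t) *: s)
                                 - phi (x + t *: s)))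
        = (fun h => h^-1 *: (phi (h *: s + (x + t *: s)) - phi (x + t *: s))).
  apply/funext => h; congr (_ *: (phi _ - _)).
  by rewrite scalerDl -scalerA scale1r addrCA.
have dphis : derivable phi (x + t *: s) s by exact: diff_derivable.
split.
  by rewrite /derivable /= /shift /comp /= dq.
rewrite -derive_gradient // /derive /= /shift /comp /=.
by rewrite dq.
Qed.

(** The difference between [phi] on the segment and the quadratic bound has a
    nonpositive derivative, by Cauchy-Schwarz and the Lipschitz condition. *)
Lemma descent phi (L : R) x s :
  (forall y, differentiable phi y) -> lipschitz_gradient phi L ->
  phi (x + s) <= phi x + dotmx (gradient phi x) s + L / 2 * enorm s ^+ 2.
Proof.
move=> dphi lip.
set c := dotmx (gradient phi x) s; move eE : (enorm s ^+ 2) => e.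
pose p : {poly R} := c *: 'X + (L / 2 * e) *: 'X^2.
pose h : R -> R := (fun t : R => phi (x + t *: s)) - horner p.
pose dh t := dotmx (gradient phi (x + t *: s)) s - (deriv p).[t].
(* [dh t] is [dotmx (grad (x + t *: s) - grad x) s - t * (L * e)]. *)
have hdh (t : R) : is_derive t 1 h (dh t).
  by apply: is_deriveB; exact: is_derive_line.
have : h 1 <= h 0.
  apply: (@derive_le0_le h dh) => // t /andP[t0 _].
  have -> : dh t = dotmx (gradient phi (x + t *: s) - gradient phi x) s
                   - t * (L * e).
    rewrite /dh dotmxDl dotmxNl /p poly.derivD !poly.derivZ poly.derivX.
    rewrite poly.derivXn.
    rewrite !(hornerD, hornerZ, hornerC, hornerMn, hornerXn) -/c.
    by field.
  suff : dotmx (gradient phi (x + t *: s) - gradient phi x) s <= t * (L * e).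
    lra.
  apply: (le_trans (dotmx_le_enorm _ _)).
  have -> : t * (L * e) = L * enorm (t *: s) * enorm s.
    by rewrite enormZ gtr0_norm // -eE; ring.
  rewrite ler_wpM2r ?enorm_ge0 //.
  by have := lip (x + t *: s) x; rewrite addrAC subrr add0r.
have hE : forall u : R, h u = phi (x + u *: s) - (c * u + L / 2 * e * u ^+ 2).
  by move=> u; rewrite -hornerXn -[X in c * X]hornerX -!hornerZ -hornerD.
rewrite !hE scale1r scale0r addr0; lra.
Qed.

End Descent.

(** * One iteration of the trust-region method *)

Section Step.
Context {R : realType} {n : nat}.
Variables (a : tr_params R) (phi : 'cV[R]_n -> R) (L1 epsf epsg keg : R).
Hypotheses (ha : tr_params_ok a).
Hypotheses (hL1 : 0 <= L1) (hepsg : 0 <= epsg).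
Hypotheses (hkeg : 0 <= keg).
Implicit Types (delta f fp : R) (x g s : 'cV[R]_n) (H : 'M[R]_n).

Lemma cauchy_radius_ge g H delta : spectral_norm H <= kbhm a ->
  Num.min (enorm g / kbhm a) delta <= cauchy_radius g H delta.
Proof.
have [_ _ _ _ [_ k0]] := ha.
move=> HH; rewrite /cauchy_radius; case: ifPn => [_|/spectral_norm_gt0 H0].
  by rewrite ge_min lexx orbT.
rewrite le_min !ge_min lexx orbT andbT ler_wpM2l ?enorm_ge0 //.
by rewrite lef_pV2 ?posrE.
Qed.

Lemma model_decreaseE x g H s :
  model_decrease phi x g H s = - dotmx g s - 2^-1 * dotmx (H *m s) s.
Proof. by rewrite /model_decrease /model !dotmx0r; lra. Qed.

Lemma model_decrease_ge0 x g H s delta : 0 < delta ->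
  spectral_norm H <= kbhm a ->
  kfcd a / 2 * enorm g * cauchy_radius g H delta <=
    model_decrease phi x g H s ->
  0 <= model_decrease phi x g H s.
Proof.
have [_ _ _ _ [/andP[kf0 _] k0]] := ha.
move=> d0 HH; apply: le_trans.
rewrite !mulr_ge0 ?enorm_ge0 ?invr_ge0 ?(ltW kf0) //.
apply: le_trans (cauchy_radius_ge _ _ HH).
by rewrite le_min (ltW d0) divr_ge0 ?enorm_ge0 // ltW.
Qed.

Lemma accepted_le x g H s f fp :
  `|f - phi x| <= epsf -> `|fp - phi (x + s)| <= epsf ->
  0 <= model_decrease phi x g H s -> accepted a phi x g H s f fp ->
  phi (x + s) <= phi x - eta1 a * model_decrease phi x g H s
                 + (2 * epsf + relax a).
Proof.
rewrite !ler_norml => /andP[f1 f2] /andP[fp1 fp2] M0 /andP[M_neq0].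
rewrite /rho; set M := model_decrease _ _ _ _ _ in M0 *.
have M_gt0 : 0 < M.
  by rewrite lt_neqAle M0 andbT eq_sym /M /model_decrease subr_eq0.
by rewrite ler_pdivlMr // => ?; lra.
Qed.

(** The constant [C3] collects what acceptance, by the factor [eta1], and the
    Cauchy decrease guarantee in units of [delta ^+ 2] when the model gradient
    is at least [eta2 * delta]. *)
Lemma C3_decrease x g H s delta : 0 < delta -> spectral_norm H <= kbhm a ->
  kfcd a / 2 * enorm g * cauchy_radius g H delta <=
    model_decrease phi x g H s ->
  eta2 a * delta <= enorm g ->
  C3 a * delta ^+ 2 <= eta1 a * model_decrease phi x g H s.
Proof.
have [/andP[e10 _] e20 _ _ [/andP[kf0 _] k0]] := ha.
move=> d0 HH cauchy big_g.
have -> : C3 a * delta ^+ 2 = eta1 a *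
    (kfcd a / 2 * (eta2 a * delta) * (Num.min (eta2 a / kbhm a) 1 * delta)).
  by rewrite /C3; field.
rewrite ler_pM2l //; apply: le_trans cauchy; apply: ler_pM.
- by rewrite !mulr_ge0 ?invr_ge0 // ltW.
- by rewrite mulr_ge0 ?(ltW d0) // le_min ler01 andbT divr_ge0 // ltW.
- by rewrite ler_wpM2l // divr_ge0 // ltW.
apply: le_trans (cauchy_radius_ge _ _ HH).
rewrite minr_pMl ?(ltW d0) // mul1r le_min !ge_min lexx orbT andbT.
by rewrite mulrAC ler_wpM2r // invr_ge0 ltW.
Qed.

Lemma C3_gt0 : 0 < C3 a.
Proof.
have [/andP[e10 _] e20 _ _ [/andP[kf0 _] k0]] := ha.
by rewrite /C3 !mulr_gt0 ?invr_gt0 // lt_min ltr01 andbT divr_gt0.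
Qed.

Let B := L1 + kbhm a + 2 * keg + (1 - eta1 a) * kfcd a * keg.

Let B_gt0 : 0 < B.
Proof.
have [/andP[_ e11] _ _ _ [/andP[kf0 _] k0]] := ha.
rewrite /B -addrA ltr_wpDr ?ltr_wpDl //.
by rewrite addr_ge0 ?mulr_ge0 // ?subr_ge0 // ltW.
Qed.

Let kegeta_gt0 : 0 < keg + eta2 a.
Proof. by have [_ e20 _ _ _] := ha; rewrite ltr_wpDl. Qed.

Lemma C1_gt0 : 0 < C1 a L1 keg.
Proof.
have [/andP[_ e11] _ _ _ [/andP[kf0 _] k0]] := ha.
by rewrite /C1 lt_min !divr_gt0 ?mulr_gt0 ?subr_gt0.
Qed.

Hypotheses (dphi : forall y, differentiable phi y).
Hypotheses (hlip : lipschitz_gradient phi L1) (hr : 2 * epsf <= relax a).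

(** The two entries of the minimum and maximum defining [C1] and [C2] give the
    two tests for enlarging the radius: the second entries make the model
    gradient exceed [eta2 * delta], the first ones make the model error at
    most [1 - eta1] times the model decrease. *)
Lemma reliable_small_radius_success x g H s delta f fp :
  0 < delta -> spectral_norm H <= kbhm a -> enorm s <= delta ->
  kfcd a / 2 * enorm g * cauchy_radius g H delta <=
    model_decrease phi x g H s ->
  `|f - phi x| <= epsf -> `|fp - phi (x + s)| <= epsf ->
  enorm (g - gradient phi x) <= keg * delta + epsg ->
  delta <= C1 a L1 keg * enorm (gradient phi x) - C2 a L1 keg * epsg ->
  accepted a phi x g H s f fp && (eta2 a * delta <= enorm g).
Proof.
have [/andP[e10 e11] e20 _ r0 [/andP[kf0 kf1] k0]] := ha.
move=> d0 HH sd cauchy hf hfp reliable small.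
set N := enorm (gradient phi x) in small.
have N0 : 0 <= N by exact: enorm_ge0.
have N_le : N <= enorm g + (keg * delta + epsg).
  have -> : N = enorm (g - (g - gradient phi x)) by rewrite opprB addrC subrK.
  by apply: (le_trans (ler_enormD _ _)); rewrite enormN lerD2l.
move cE : ((1 - eta1 a) * kfcd a : R) => c.
have BE : B = L1 + kbhm a + 2 * keg + c * keg by rewrite /B cE.
have small1 : delta * (keg + eta2 a) <= N - epsg.
  have : delta <= (1 / (keg + eta2 a)) * (N - epsg).
    apply: le_trans small _; rewrite mulrBr lerB // ler_wpM2r //.
      by rewrite /C1 ge_min lexx orbT.
    by rewrite /C2 le_max lexx orbT.
  by rewrite mulrAC mul1r ler_pdivlMr.
have small2 : delta * B <= c * N - (c + 2) * epsg.
  have : delta <= (c / B) * N - ((c + 2) / B) * epsg.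
    apply: le_trans small _; rewrite lerB // ler_wpM2r //.
      by rewrite /C1 cE BE ge_min lexx.
    by rewrite /C2 cE BE le_max lexx.
  rewrite [leRHS](_ : _ = (c * N - (c + 2) * epsg) / B) ?ler_pdivlMr //.
  by field; rewrite gt_eqF.
have big_g : eta2 a * delta <= enorm g by lra.
rewrite big_g andbT.
have g0 : 0 < enorm g by apply: lt_le_trans big_g; exact: mulr_gt0.
have c0 : 0 < c by rewrite -cE mulr_gt0 // subr_gt0.
have c1 : c <= 1.
  by rewrite -cE mulr_ile1 ?subr_ge0 ?(ltW e11) ?(ltW kf0) // gerBl ltW.
have err : (L1 + kbhm a + 2 * keg) * delta + 2 * epsg <= c * enorm g.
  have : c * N <= c * (enorm g + (keg * delta + epsg)) by rewrite ler_pM2l.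
  move: small2; rewrite BE; lra.
have M_ge : kfcd a / 2 * (enorm g * delta) <= model_decrease phi x g H s.
  apply: le_trans cauchy; rewrite mulrA ler_wpM2l //.
    by rewrite mulr_ge0 ?enorm_ge0 // divr_ge0 // ltW.
  apply: le_trans (cauchy_radius_ge _ _ HH).
  rewrite le_min lexx andbT ler_pdivlMr //.
  have : c * enorm g <= enorm g by rewrite ler_piMl ?enorm_ge0.
  have : 0 <= (L1 + 2 * keg) * delta.
    by rewrite mulr_ge0 ?addr_ge0 ?mulr_ge0 // ltW.
  move: hepsg; lra.
have M_gt0 : 0 < model_decrease phi x g H s.
  by apply: lt_le_trans M_ge; rewrite !mulr_gt0 ?invr_gt0.
rewrite /accepted -subr_eq0 -/(model_decrease _ _ _ _ _) gt_eqF //=.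
rewrite /rho ler_pdivlMr //.
have phis := descent x s dphi hlip.
have grad_err : dotmx (gradient phi x - g) s <= (keg * delta + epsg) * delta.
  apply: (le_trans (dotmx_le_enorm _ _)); apply: ler_pM; rewrite ?enorm_ge0 //.
  by rewrite -enormN opprB.
have hess_err : - dotmx (H *m s) s <= kbhm a * delta ^+ 2.
  rewrite -dotmxNl (le_trans (dotmx_le_enorm _ _)) // enormN.
  rewrite expr2 mulrA; apply: ler_pM; rewrite ?enorm_ge0 //.
  apply: (le_trans (enorm_mulmx _ _)).
  apply: (@le_trans _ _ (kbhm a * enorm s)).
    by rewrite ler_wpM2r ?enorm_ge0.
  by rewrite ler_pM2l.
have lip_err : L1 / 2 * enorm s ^+ 2 <= L1 / 2 * delta ^+ 2.
  by rewrite ler_wpM2l ?divr_ge0 // ler_sqr ?nnegrE ?enorm_ge0 // ltW.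
have errd : ((L1 + kbhm a + 2 * keg) * delta + 2 * epsg) * delta
            <= c * enorm g * delta by rewrite ler_pM2r.
have decM : c * enorm g * delta <=
    2 * (1 - eta1 a) * model_decrease phi x g H s.
  have -> : c * enorm g * delta
    = 2 * (1 - eta1 a) * (kfcd a / 2 * (enorm g * delta)) by rewrite -cE; field.
  by rewrite ler_pM2l // mulr_gt0 // subr_gt0.
move: hf hfp; rewrite !ler_norml => /andP[f1 f2] /andP[fp1 fp2].
move: grad_err; rewrite dotmxDl dotmxNl => grad_err.
have := model_decreaseE x g H s.
move: (model_decrease _ _ _ _ _) decM hr => M decM.
lra.
Qed.

End Step.

(** * Radii on a logarithmic scale *)

Section Trajectory.
Context {R : realType}.

(** The radii reachable from [delta0] form the progression
    [delta0 * gam ^ z]; this picks its representative in [(gam * D, D]], the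
    exponent being the ceiling of a logarithm. *)
Lemma ceil_log_radius (gam D delta0 : R) : 0 < gam < 1 -> 0 < D -> 0 < delta0 ->
  exists2 z : int, gam * D < delta0 * gam ^ z <= D &
    `|z%:~R : R| <= `|logb gam (D / delta0)| + 1.
Proof.
move=> /andP[g0 g1] D0 d0; set l := logb gam (D / delta0).
exists (Num.ceil l); last first.
  have := ceil_ge l; have := ceilB1_lt l; rewrite intrD intrN !ler_norml.
  have := ler_norm l; have := lerNnormlW (lexx `|l|).
  by move=> *; apply/andP; split; lra.
have lng : ln gam < 0 by rewrite ln_lt0 // g0.
have lE : l * ln gam = ln D - ln delta0.
  by rewrite /l /logb divfK ?lt_eqF // lnM ?posrE ?invr_gt0 // lnV.
have lnz : ln (delta0 * gam ^ Num.ceil l) =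
    ln delta0 + (Num.ceil l)%:~R * ln gam.
  by rewrite lnM ?posrE ?exprz_gt0 // -powR_intmul ?(ltW g0) // ln_powR.
apply/andP; split.
  rewrite -ltr_ln ?posrE ?mulr_gt0 ?exprz_gt0 // lnz lnM ?posrE //.
  have : (l - (Num.ceil l)%:~R + 1) * ln gam < 0.
    have := ceilB1_lt l; rewrite intrD intrN => ?.
    by rewrite nmulr_llt0 //; lra.
  by rewrite !mulrDl lE mulNr mul1r; lra.
rewrite -ler_ln ?posrE ?mulr_gt0 ?exprz_gt0 // lnz.
have : ((Num.ceil l)%:~R - l) * ln gam <= 0.
  by rewrite mulr_ge0_le0 ?(ltW lng) // subr_ge0 ceil_ge.
by rewrite mulrBl lE; lra.
Qed.

(** The two entries of [radius_ratio] bound the logarithm from both sides: the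
    second one is at most [delta0 / D]. *)
Lemma normr_log_le (gam D V delta0 : R) : 0 < gam < 1 -> 0 < delta0 ->
  0 < D < V ->
  `|logb gam (D / delta0)| <= logb gam (radius_ratio delta0 D V).
Proof.
move=> /andP[g0 g1] d0 /andP[D0 DV]; have V0 := lt_trans D0 DV.
have lng : ln gam < 0 by rewrite ln_lt0 // g0.
have anti (u v : R) : 0 < u -> u <= v -> logb gam v <= logb gam u.
  move=> u0 uv; rewrite /logb ler_wnM2r ?invr_le0 ?(ltW lng) //.
  by rewrite ler_ln ?posrE // (lt_le_trans u0).
rewrite /radius_ratio (lt_geF V0); set m := Num.min _ _.
have m0 : 0 < m by rewrite lt_min !divr_gt0.
rewrite ler_norml; apply/andP; split; last first.
  by apply: anti => //; rewrite ge_min lexx.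
rewrite lerNl.
have -> : - logb gam (D / delta0) = logb gam (delta0 / D).
  by rewrite /logb -mulNr -lnV ?posrE ?divr_gt0 // invf_div.
apply: anti => //; apply: (@le_trans _ _ (delta0 / V)).
  by rewrite ge_min lexx orbT.
by rewrite ler_pM2l // lef_pV2 ?posrE // ltW.
Qed.

End Trajectory.

(** * Counting reliable iterations along a realization *)

Section Counting.
Context {R : realType} {n : nat}.
Variables (a : tr_params R) (phi : 'cV[R]_n -> R) (L1 epsf epsg keg : R).
Hypotheses (ha : tr_params_ok a).
Hypotheses (hL1 : 0 <= L1) (hepsf : 0 <= epsf) (hepsg : 0 <= epsg).
Hypotheses (hkeg : 0 <= keg).
Hypotheses (dphi : forall y, differentiable phi y).
Hypotheses (hlip : lipschitz_gradient phi L1) (hr : 2 * epsf <= relax a).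
Variables (x0 : 'cV[R]_n) (delta0 : R) (x : nat -> 'cV[R]_n).
Variables (delta : nat -> R) (g : nat -> 'cV[R]_n) (H : nat -> 'M[R]_n).
Variables (s : nat -> 'cV[R]_n) (f fp : nat -> R).
Hypotheses (run : tr_trajectory a phi x0 delta0 x delta g H s f fp).
Hypotheses (hf : forall k, `|f k - phi (x k)| <= epsf).
Hypotheses (hfp : forall k, `|fp k - phi (x k + s k)| <= epsf).
Hypotheses (hdelta0 : 0 < delta0).

Definition reliable k :=
  enorm (g k - gradient phi (x k)) <= keg * delta k + epsg.

Let success k := accepted a phi (x k) (g k) (H k) (s k) (f k) (fp k) &&
  (eta2 a * delta k <= enorm (g k)).

Lemma radius_gt0 k : 0 < delta k.
Proof.
have [_ _ /andP[g0 _] _ _] := ha.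
elim: k => [|k IH]; first by rewrite (tr_delta0 run).
rewrite (tr_delta_next run).
by case: ifP => _; [case: ifP => _|]; rewrite mulr_gt0 ?invr_gt0.
Qed.

Let radius_next k : delta k.+1 =
  if success k then (gamma a)^-1 * delta k else gamma a * delta k.
Proof. by rewrite (tr_delta_next run) /success; case: accepted. Qed.

Let decrease_ge0 k : 0 <= model_decrease phi (x k) (g k) (H k) (s k).
Proof.
exact: model_decrease_ge0 (radius_gt0 k) (tr_H_bound run k) (tr_cauchy run k).
Qed.

Let phi_next k : phi (x k.+1) <= phi (x k) + (2 * epsf + relax a).
Proof.
have [/andP[e10 _] _ _ r0 _] := ha.
rewrite (tr_x_next run); case: ifPn => [acc|_]; last first.
  by move: r0 hepsf; lra.
have := accepted_le (hf k) (hfp k) (decrease_ge0 k) acc.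
have := mulr_ge0 (ltW e10) (decrease_ge0 k); lra.
Qed.

Let phi_success k : success k ->
  phi (x k.+1) <= phi (x k) - C3 a * delta k ^+ 2 + (2 * epsf + relax a).
Proof.
move=> /andP[acc big_g]; rewrite (tr_x_next run) acc.
have := accepted_le (hf k) (hfp k) (decrease_ge0 k) acc.
have := C3_decrease ha (radius_gt0 k) (tr_H_bound run k) (tr_cauchy run k)
  big_g.
lra.
Qed.

Let success_reliable k (D : R) : reliable k -> delta k <= D ->
  D < C1 a L1 keg * enorm (gradient phi (x k)) - C2 a L1 keg * epsg ->
  success k.
Proof.
move=> rel dD DV.
exact: (reliable_small_radius_success ha hL1 hepsg hkeg dphi hlip hr
  (radius_gt0 k) (tr_H_bound run k) (tr_s_bound run k) (tr_cauchy run k)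
  (hf k) (hfp k) rel (le_trans dD (ltW DV))).
Qed.

(** If the radius grows from an exponent [z >= 0], it was larger than
    [gamma * D], so [phi / K] loses 1 and [`|z| / 2] gains 1/2.  If it grows
    from [z < 0] or shrinks from [z > 0], then [`|z| / 2] loses 1/2.  If it
    shrinks from [z <= 0], then [`|z| / 2] gains 1/2, but the radius was at most
    [D] and the iteration failed, so it was not reliable. *)
Lemma potential_step (D B K : R) k (z : int) : 0 < D ->
  gamma a * D < B <= D -> K = C3 a * gamma a ^+ 2 * D ^+ 2 ->
  D < C1 a L1 keg * enorm (gradient phi (x k)) - C2 a L1 keg * epsg ->
  delta k = B * gamma a ^ (- z) ->
  exists2 z' : int, delta k.+1 = B * gamma a ^ (- z') &
    phi (x k.+1) / K + `|z'%:~R| / 2 + (reliable k)%:R <=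
    phi (x k) / K + `|z%:~R| / 2 + ((2 * epsf + relax a) / K + 1 / 2).
Proof.
have [_ _ /andP[g0 g1] _ _] := ha.
move=> D0 /andP[gDB BD] KE DV dE.
have gN0 : gamma a != 0 by rewrite gt_eqF.
have C30 := C3_gt0 ha.
have K0 : 0 < K by rewrite KE mulr_gt0 ?exprn_gt0 // mulr_gt0 ?exprn_gt0.
have B0 : 0 < B by apply: lt_trans gDB; rewrite mulr_gt0.
have pow_ge1 (m : int) : 0 <= m -> 1 <= gamma a ^ (- m).
  case: m => // m _; rewrite -invr_expz invf_ge1 ?exprz_gt0 //.
  by rewrite exprn_ile1 ?ltW.
have norm_pos (m : int) : 0 <= m -> `|(m + 1)%:~R : R| = `|m%:~R| + 1.
  by move=> m0; rewrite !ger0_norm ?ler0z ?addr_ge0 // intrD.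
have norm_neg (m : int) : m <= 0 -> `|(m - 1)%:~R : R| = `|m%:~R| + 1.
  move=> m0; rewrite -normrN -intrN opprB addrC norm_pos ?oppr_ge0 //.
  by rewrite intrN normrN.
have I1 : (reliable k)%:R <= 1 :> R by case: reliable.
have phiK : phi (x k.+1) / K <= phi (x k) / K + (2 * epsf + relax a) / K.
  by rewrite -mulrDl ler_pM2r ?invr_gt0.
have [suc|fail] := boolP (success k).
- exists (z + 1).
    by rewrite radius_next suc dE opprD expfzDr // exprN1; ring.
  have [z0|z0] := leP 0 z.
    have delta_big : gamma a * D <= delta k.
      by rewrite dE (le_trans (ltW gDB)) // ler_peMr ?pow_ge1 // ltW.
    have phiK' : phi (x k.+1) / K <=
        phi (x k) / K - 1 + (2 * epsf + relax a) / K.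
      have -> : phi (x k) / K - 1 + (2 * epsf + relax a) / K
        = (phi (x k) - K + (2 * epsf + relax a)) / K by field; rewrite gt_eqF.
      rewrite ler_pM2r ?invr_gt0 //; have := phi_success suc.
      have : K <= C3 a * delta k ^+ 2.
        rewrite KE -mulrA ler_pM2l // -exprMn ler_sqr ?nnegrE //.
          by rewrite mulr_ge0 ?ltW.
        exact: ltW (radius_gt0 k).
      lra.
    by rewrite norm_pos //; lra.
  have := norm_neg (z + 1); rewrite addrK => -> //; first by lra.
  by rewrite lezD1.
exists (z - 1).
  by rewrite radius_next (negbTE fail) dE opprB addrC expfzDr // expr1z; ring.
have [z0|z0] := leP z 0.
  have delta_small : delta k <= D.
    rewrite dE (le_trans _ BD) // ler_piMr ?(ltW B0) //.
    have := pow_ge1 (- z); rewrite oppr_ge0 => /(_ z0).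
    by rewrite -invr_expz invf_ge1 ?exprz_gt0.
  have -> : reliable k = false.
    by apply/negbTE; apply: contraNN fail => rel; exact: success_reliable DV.
  by rewrite norm_neg //= mulr0n; lra.
have := norm_pos (z - 1); rewrite subrK => ->; first by lra.
by rewrite subr_ge0 -gtz0_ge1.
Qed.

Lemma reliable_count_le (D K phihat : R) T : 0 < D ->
  K = C3 a * gamma a ^+ 2 * D ^+ 2 ->
  (forall y, phihat <= phi y) ->
  (forall k, (k < T)%N ->
    D < C1 a L1 keg * enorm (gradient phi (x k)) - C2 a L1 keg * epsg) ->
  \sum_(k < T) (reliable k)%:R <= (phi x0 - phihat) / K
    + (`|logb (gamma a) (D / delta0)| + 1) / 2
    + T%:R * ((2 * epsf + relax a) / K + 1 / 2).
Proof.
move=> D0 KE hphihat DV.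
have [_ _ g01 _ _] := ha; have [g0 g1] := andP g01.
have K0 : 0 < K.
  by rewrite KE mulr_gt0 ?exprn_gt0 // mulr_gt0 ?exprn_gt0 ?C3_gt0.
have [z0 B_itv z0_le] := ceil_log_radius g01 D0 hdelta0.
set B := delta0 * gamma a ^ z0 in B_itv.
have [z _] : exists2 z : int, delta T = B * gamma a ^ (- z) &
    phi (x T) / K + `|z%:~R| / 2 + \sum_(k < T) (reliable k)%:R <=
    phi x0 / K + `|z0%:~R| / 2 + T%:R * ((2 * epsf + relax a) / K + 1 / 2).
  elim: T DV => [|T IH] DV.
    exists z0; last by rewrite (tr_x0 run) big_ord0 mul0r.
    by rewrite (tr_delta0 run) /B -mulrA -expfzDr ?gt_eqF // subrr expr0z mulr1.
  have [z zE zle] := IH (fun k kT => DV k (ltnW kT)).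
  have [z' zE' zle'] := potential_step D0 B_itv KE (DV T (ltnSn T)) zE.
  exists z' => //; rewrite big_ord_recr /= -(natr1 T).
  rewrite [(T%:R + 1) * _]mulrDl mul1r; lra.
have : phihat / K <= phi (x T) / K by rewrite ler_pM2r ?invr_gt0.
have : 0 <= `|z%:~R| :> R by [].
rewrite mulrBl; lra.
Qed.

End Counting.

(** * Exponential moments of a Bernoulli variable *)

Section Scalar.
Context {R : realType}.
Implicit Types x t p : R.

Lemma is_derive_expR_poly (q : {poly R}) x :
  is_derive x 1 (expR \o horner q) (expR q.[x] * (deriv q).[x]).
Proof. exact: is_derive1_comp. Qed.

(** The inequality [tanh x <= x], freed of its denominator. *)
Lemma expR_antisym_le x : 0 <= x -> (1 - x) * expR x <= (1 + x) * expR (- x).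
Proof.
move=> x0.
pose v : R -> R :=
  horner (1 - 'X) * expR - horner (1 + 'X) * (expR \o horner (- 'X)).
pose dv (y : R) : R := - y * expR y + y * expR (- y).
have vE y : v y = (1 - y) * expR y - (1 + y) * expR (- y).
  by rewrite /v !fctE /= !hornerE.
have : v x <= v 0.
  apply: (@derive_le0_le R v dv) => // y.
    have d1 := is_deriveM (is_derive_poly (1 - 'X) y) (is_derive_expR y).
    have d2 := is_deriveM (is_derive_poly (1 + 'X) y)
      (is_derive_expR_poly (- 'X) y).
    apply: (is_derive_eq (is_deriveB d1 d2)).
    rewrite /dv poly.derivB poly.derivD poly.derivN poly.derivX -[1]/(1%:P).
    by rewrite poly.derivC /= !hornerE /GRing.scale /=; ring.
  move=> /andP[y0 _]; rewrite /dv.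
  have : expR (- y) <= expR y by rewrite ler_expR; lra.
  nra.
by rewrite !vE oppr0 expR0; lra.
Qed.

(** The function [expR (- (y ^+ 2 / 2)) * (expR y + expR (- y))] decreases on
    the nonnegative half-line. *)
Lemma cosh_le_expR x : 0 <= x ->
  (expR x + expR (- x)) / 2 <= expR (x ^+ 2 / 2).
Proof.
move=> x0.
pose p1 : {poly R} := 'X - 2^-1 *: 'X^2.
pose p2 : {poly R} := - 'X - 2^-1 *: 'X^2.
pose u : R -> R := (expR \o horner p1) + (expR \o horner p2).
have p1E y : p1.[y] = y - y ^+ 2 / 2.
  by rewrite /p1 !(hornerD, hornerN, hornerX, hornerZ, hornerXn); lra.
have p2E y : p2.[y] = - y - y ^+ 2 / 2.
  by rewrite /p2 !(hornerD, hornerN, hornerX, hornerZ, hornerXn); lra.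
have uE y : u y = expR (- (y ^+ 2 / 2)) * (expR y + expR (- y)).
  rewrite (_ : u y = expR p1.[y] + expR p2.[y]) // p1E p2E mulrDr -!expRD.
  by congr (expR _ + expR _); lra.
pose du (y : R) : R :=
  expR (- (y ^+ 2 / 2)) * ((1 - y) * expR y - (1 + y) * expR (- y)).
have : u x <= u 0.
  apply: (@derive_le0_le R u du 0 x) => // y.
    apply: (is_derive_eq (is_deriveD (is_derive_expR_poly p1 y)
      (is_derive_expR_poly p2 y))).
    rewrite p1E p2E !expRD.
    rewrite /p1 /p2 !poly.derivB poly.derivN poly.derivZ poly.derivX.
    rewrite poly.derivXn.
    rewrite !(hornerD, hornerZ, hornerC, hornerMn, hornerXn, hornerN) /du.
    by field.
  move=> /andP[y0 _]; rewrite /du mulr_ge0_le0 ?expR_ge0 // subr_le0.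
  by apply: expR_antisym_le; exact: ltW.
rewrite !uE expr0n mul0r oppr0 expR0 mul1r.
rewrite expRN mulrC ler_pdivrMr ?expR_gt0 //. lra.
Qed.

(** The left-hand side is Markov's bound, with parameter [2 * t], on the
    probability that a Bernoulli variable is at most [p * (1 - t)].  At
    [p = 1 / 2] it equals [expR (- t ^+ 2) * cosh t], whence the rate
    [t ^+ 2 / 2].  A larger [p] contributes the factor
    [1 - (2 * p - 1) * tanh t], and [tanh t >= t * (1 - t)] makes it compensate
    the growth of [expR (2 * t * (p * (1 - t)))]. *)
Lemma bernoulli_expR_le p t : 1 / 2 <= p -> 0 <= t <= 1 ->
  (1 - p * (1 - expR (- (2 * t)))) * expR (2 * t * (p * (1 - t))) <=
  expR (- (t ^+ 2 / 2)).
Proof.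
move=> p2 /andP[t0 t1]; set w := expR (- (2 * t)).
have w0 : 0 < w by exact: expR_gt0.
have w1 : w * (1 + 2 * t) <= 1.
  rewrite /w expRN mulrC ler_pdivrMr ?expR_gt0 // mul1r.
  exact: expR_ge1Dx.
(* The quotient [(1 - w) / (1 + w)] is [tanh t]. *)
have tanh_ge : (1 + w) * (t * (1 - t)) <= 1 - w.
  have : (1 + 2 * t) * ((1 + w) * (t * (1 - t))) <= (1 + 2 * t) * (1 - w).
    have : 0 <= (1 - w * (1 + 2 * t)) * (1 + t * (1 - t)).
      by rewrite mulr_ge0 ?subr_ge0 // addr_ge0 // mulr_ge0 // subr_ge0.
    have : 0 <= t ^+ 3 by rewrite exprn_ge0.
    lra.
  by rewrite ler_pM2l //; lra.
have half : (1 + w) / 2 <= expR (- t + t ^+ 2 / 2).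
  have -> : (1 + w) / 2 = expR (- t) * ((expR t + expR (- t)) / 2).
    rewrite mulrA mulrDr -!expRD addNr expR0.
    by congr (_ / _); congr (1 + expR _); lra.
  by rewrite expRD ler_pM2l ?expR_gt0 // cosh_le_expR.
pose v := 1 - (2 * p - 1) * (t * (1 - t)).
have tilt : 1 - p * (1 - w) <= (1 + w) / 2 * v.
  have : (2 * p - 1) * ((1 + w) * (t * (1 - t))) <= (2 * p - 1) * (1 - w).
    by rewrite ler_wpM2l //; lra.
  rewrite /v; lra.
have v_le : v <= expR (- ((2 * p - 1) * (t * (1 - t)))) by exact: expR_ge1Dx.
have : 1 - p * (1 - w) <=
    expR (- t + t ^+ 2 / 2) * expR (- ((2 * p - 1) * (t * (1 - t)))).
  apply: (le_trans tilt).
  apply: (@le_trans _ _ ((1 + w) / 2 * expR (- ((2 * p - 1) * (t * (1 - t)))))).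
    by rewrite ler_pM2l //; lra.
  by rewrite ler_pM2r ?expR_gt0.
rewrite -(ler_pM2r (expR_gt0 (2 * t * (p * (1 - t))))) => /le_trans; apply.
rewrite -!expRD ler_expR; lra.
Qed.

End Scalar.

Lemma bernoulli_expR_le_pow (R : realType) (p t : R) (T : nat) :
  1 / 2 <= p <= 1 -> 0 <= t <= 1 ->
  expR (2 * t * (p * (1 - t) * T%:R)) * (1 - p * (1 - expR (- (2 * t)))) ^+ T <=
  expR (- (t ^+ 2 / 2 * T%:R)).
Proof.
move=> /andP[p2 p1] t01; have [t0 t1] := andP t01.
have q_le1 : p * (1 - expR (- (2 * t))) <= 1.
  have ? : expR (- (2 * t)) <= 1 by rewrite -[leRHS]expR0 ler_expR; lra.
  have ? := expR_gt0 (- (2 * t)).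
  by apply: mulr_ile1; lra.
rewrite mulrA expRM_natr -exprMn mulrC -[in leRHS]mulNr expRM_natr.
apply: lerXn2r; rewrite ?nnegrE ?expR_ge0 ?mulr_ge0 ?expR_ge0 ?subr_ge0 //.
exact: bernoulli_expR_le.
Qed.

(** * Measurable functions of random vectors *)

Section Measurability.
Context {R : realType} {d : measure_display} {T : measurableType d} {n : nat}.
Implicit Types (X Y : T -> 'cV[R]_n) (u : 'cV[R]_n -> R).

(** An open set is the union of the countably many cubes with rational centre
    and radius [m.+1%:R^-1] that it contains. *)
Lemma measurable_preimage_open X (O : set 'cV[R]_n) :
  (forall i, measurable_fun setT (fun w => X w i 0)) -> open O ->
  measurable (X @^-1` O).
Proof.
move=> mX oO.
pose box (c : 'cV[rat]_n * nat) : set 'cV[R]_n :=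
  [set y | forall i, `|y i 0 - ratr (c.1 i 0)| < c.2.+1%:R^-1].
have mbox c : measurable (X @^-1` box c).
  have -> : X @^-1` box c = \bigcap_(i in [set: 'I_n])
      (fun w => X w i 0) @^-1` ball (ratr (c.1 i 0) : R) c.2.+1%:R^-1.
    apply/seteqP; split=> [w cw i _|w cw i].
      by rewrite /preimage /= -ball_normE /= distrC; exact: cw.
    by have := cw i I; rewrite /preimage /= -ball_normE /= distrC.
  apply: fin_bigcap_measurable => // i _.
  rewrite -[X in measurable X]setTI; apply: mX => //.
  by apply: open_measurable; apply: ball_open; rewrite invr_gt0.
have -> : X @^-1` O =
    \bigcup_c (if `[< box c `<=` O >] then X @^-1` box c else set0).
  apply/seteqP; split=> [w /= Ow|w [c _]]; last first.
    by case: asboolP => // cO /cO.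
  have /nbhs_ballP[e /= e0 eO] := open_nbhs_nbhs (conj oO Ow).
  have [m mE] : exists m : nat, m.+1%:R^-1 < e / 2.
    have /ltr_add_invr[m] : 0 < e / 2 by rewrite divr_gt0.
    by rewrite add0r; exists m.
  have [q qE] : exists q : 'cV[rat]_n, forall i,
      `|X w i 0 - ratr (q i 0)| < m.+1%:R^-1.
    have near i : exists q : rat, `|X w i 0 - ratr q| < m.+1%:R^-1.
      have : X w i 0 - m.+1%:R^-1 < X w i 0 + m.+1%:R^-1.
        by rewrite ltrD2l (@lt_trans _ _ 0) ?oppr_lt0 ?invr_gt0.
      move=> /rat_in_itvoo[q]; rewrite in_itv /= => /andP[q1 q2].
      by exists q; rewrite distrC ltr_distl q1.
    have [q qE] := choice near.
    by exists (\col_i q i) => i; rewrite mxE.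
  exists (q, m) => //; case: asboolP => // -[y yE]; apply: eO.
  split=> // i j; rewrite -ball_normE /= (ord1 j).
  have := yE i; have := qE i => /= h1 h2.
  apply: (le_lt_trans (ler_distD (ratr (q i 0)) _ _)).
  move: mE h1 h2; rewrite (distrC _ (y i 0)); move: (m.+1%:R^-1) => r; lra.
apply: countable_bigcupT_measurable => [|c]; first exact: countableP.
by case: ifP.
Qed.

Lemma measurable_continuous_comp X u :
  (forall i, measurable_fun setT (fun w => X w i 0)) -> continuous u ->
  measurable_fun setT (u \o X).
Proof.
move=> mX cu; apply: (measurability _ (RGenOpens.measurableE R)).
move=> _ [_ [a [b ->]] <-]; rewrite setTI comp_preimage.
apply: measurable_preimage_open => //.
by move/continuousP : cu; apply; exact: interval_open.
Qed.

Lemma measurable_enorm Y : (forall i, measurable_fun setT (fun w => Y w i 0)) ->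
  measurable_fun setT (fun w => enorm (Y w)).
Proof.
move=> mY.
rewrite (_ : (fun _ => _) = Num.sqrt \o (fun w => dotmx (Y w) (Y w))) //.
apply: measurableT_comp.
  by apply: continuous_measurable_fun; exact: sqrt_continuous.
apply: measurable_sum => i; apply: measurable_sum => j.
by rewrite (ord1 j); apply: measurable_funM; exact: mY.
Qed.

End Measurability.

(** * The binomial tail of adapted trials *)

Section AdaptedTrials.
Context {R : realType} {d : measure_display} {Omega : measurableType d}.
Variable P : probability Omega R.

Let Pr (A : set Omega) : R := fine (P A).

Let PrE A : measurable A -> P A = (Pr A)%:E.
Proof. by move=> mA; rewrite fineK // fin_num_measure. Qed.

(** A version [h] of the conditional probability may fall below [p] on a null
    set; replacing it by [Num.max p h] does not change its integrals. *)
Lemma cond_prob_ge_setI (F : set_system Omega) (E A : set Omega) (p : R) :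
  0 <= p -> F A -> measurable A -> cond_prob_ge P F E p ->
  (p%:E * P A <= P (A `&` E))%E.
Proof.
move=> p0 FA mA [h [hF hint hE] ph]; rewrite -hE // -integral_cst //.
have mh : measurable_fun A (EFin \o h).
  by apply: measurable_funTS; exact: measurable_int hint.
have mmax : measurable_fun A (fun w => (Num.max p (h w))%:E).
  apply/measurable_EFinP; apply: measurable_maxr => //.
  exact/measurable_EFinP.
have -> : (\int[P]_(w in A) (h w)%:E = \int[P]_(w in A) (Num.max p (h w))%:E)%E.
  apply: ae_eq_integral => //.
  by apply: filterS ph => w pw _ /=; rewrite (max_idPr pw).
apply: ge0_le_integral => //.
by move=> w _; rewrite lee_fin le_max lexx.
Qed.

Definition count_trials (I : nat -> Omega -> bool) k w : nat :=
  \sum_(i < k) I i w.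

Variables (F : nat -> set_system Omega) (I : nat -> Omega -> bool) (p : R).
Hypotheses (F_sigma : forall k, sigma_algebra setT (F k)).
Hypotheses (F_mono : forall k, F k `<=` F k.+1).
Hypotheses (F_meas : forall k, F k `<=` measurable).
Hypotheses (I_adapted : forall k, F k.+1 [set w | I k w]).
Hypotheses (I_prob : forall k, cond_prob_ge P (F k) [set w | I k w] p).
Hypotheses (p0 : 0 <= p) (p1 : p <= 1).

Let C k j := [set w | count_trials I k w = j].

Lemma count_trialsS k w :
  count_trials I k.+1 w = (count_trials I k w + I k w)%N.
Proof. by rewrite /count_trials big_ord_recr. Qed.

Lemma count_trials_le k w : (count_trials I k w <= k)%N.
Proof.
elim: k => [|k IH]; first by rewrite /count_trials big_ord0.
by rewrite count_trialsS -addn1 leq_add // leq_b1.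
Qed.

Let CS k j : C k.+1 j = (C k j `\` [set w | I k w]) `|`
  ((if j is i.+1 then C k i else set0) `&` [set w | I k w]).
Proof.
apply/seteqP; split=> w.
  rewrite /C /= count_trialsS; case: (I k w) => /=.
    by rewrite addn1 => <-; right.
  by rewrite addn0 => <-; left.
rewrite /C /= count_trialsS => -[[<-]|].
  by case: (I k w) => // _; rewrite addn0.
by case: j => [[]|j] //= [<- ->]; rewrite addn1.
Qed.

Let FC k j : F k (C k j).
Proof.
elim: k j => [|k IH] j.
  have C0 : C 0 j = if j == 0%N then setT else set0.
    apply/seteqP; split=> w; rewrite /C /= /count_trials big_ord0.
      by move=> <-.
    by case: eqP.
  rewrite C0 -(measurable_g_measurableTypeE (F_sigma 0)).
  by case: ifP => _; [exact: measurableT|exact: measurable0].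
rewrite CS -(measurable_g_measurableTypeE (F_sigma k.+1)).
have mI : (F k.+1).-sigma.-measurable [set w | I k w].
  by rewrite measurable_g_measurableTypeE.
have mC i : (F k.+1).-sigma.-measurable (C k i).
  by rewrite measurable_g_measurableTypeE //; apply: F_mono.
apply: measurableU; first exact: measurableD.
by apply: measurableI => //; case: (j).
Qed.

Let mC k j : measurable (C k j). Proof. exact: F_meas (FC k j). Qed.

Let mI k : measurable [set w | I k w]. Proof. exact: F_meas (I_adapted k). Qed.

Let count_le_bigcup (c : R) T : [set w | (count_trials I T w)%:R <= c] =
    \big[setU/set0]_(j < T.+1) if j%:R <= c then C T j else set0.
Proof.
rewrite -(bigcup_mkord T.+1 (fun j : nat => if j%:R <= c then C T j else set0)).
apply/seteqP; split=> w /=.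
  move=> wc; exists (count_trials I T w); last by rewrite wc.
  by rewrite /= ltnS count_trials_le.
by move=> [j _]; case: ifP => // jc; rewrite /C /= => ->.
Qed.

Lemma measurable_count_le (c : R) T :
  measurable [set w | (count_trials I T w)%:R <= c].
Proof.
rewrite count_le_bigcup; apply: bigsetU_measurable => j _.
by case: ifP.
Qed.

(** The sum is the expectation of [w ^+ count_trials I k].  Trial [k] multiplies
    the weight of the event [count_trials I k = j], which belongs to the past,
    by [1 - (1 - w) * q] with [q >= p] the conditional probability of success.
    Working on these finitely many events, conditional probabilities of sets
    suffice. *)
Lemma count_moment_le (w : R) k : 0 <= w <= 1 ->
  \sum_(j < k.+1) w ^+ j * Pr (C k j) <= (1 - p * (1 - w)) ^+ k.
Proof.
move=> /andP[w0 w1].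
elim: k => [|k IH].
  by rewrite big_ord1 expr0 mul1r -lee_fin -PrE // probability_le1.
have split_C j : Pr (C k.+1 j) = Pr (C k j `\` [set w | I k w]) +
    Pr ((if j is i.+1 then C k i else set0) `&` [set w | I k w]).
  apply: EFin_inj; rewrite EFinD -!PrE //; last 2 first.
  - by apply: measurableI => //; case: (j).
  - exact: measurableD.
  rewrite CS measureU //.
  - exact: measurableD.
  - by apply: measurableI => //; case: (j).
  by apply/seteqP; split=> v //= [[_ nI] [_ /nI]].
have split_I j : Pr (C k j) = Pr (C k j `\` [set w | I k w]) +
    Pr (C k j `&` [set w | I k w]).
  apply: EFin_inj; rewrite EFinD -!PrE ?(measureDI P (mC k j) (mI k)) //.
  - exact: measurableI.
  - exact: measurableD.
have step j : Pr (C k j `\` [set w | I k w]) +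
    w * Pr (C k j `&` [set w | I k w]) <= (1 - p * (1 - w)) * Pr (C k j).
  have := cond_prob_ge_setI p0 (FC k j) (mC k j) (I_prob k).
  rewrite !PrE //; last exact: measurableI.
  rewrite -EFinM lee_fin => pC.
  have : (1 - w) * (p * Pr (C k j)) <=
      (1 - w) * Pr (C k j `&` [set w | I k w]).
    by rewrite ler_wpM2l // subr_ge0.
  have := split_I j; lra.
under eq_bigr do rewrite split_C mulrDr.
(* The failures cannot fill the level [k.+1], nor the successes the level 0. *)
rewrite big_split /= big_ord_recr /= [X in _ + X]big_ord_recl /=.
have -> : C k k.+1 = set0.
  apply/seteqP; split=> v //= vk; have := count_trials_le k v.
  by rewrite vk ltnn.
rewrite set0D set0I /Pr measure0 /= !mulr0 addr0 add0r -big_split /= exprS.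
apply: le_trans (ler_wpM2l _ IH); last first.
  have : p * (1 - w) <= 1 by rewrite mulr_ile1 ?subr_ge0 // gerBl.
  by rewrite subr_ge0.
rewrite mulr_sumr; apply: ler_sum => j _.
rewrite /bump /= add1n exprSr -mulrA -mulrDr mulrCA ler_wpM2l ?exprn_ge0 //.
exact: step.
Qed.

(** Markov's inequality for [expR (- lam * count_trials I T)], summed over the
    values of the count. *)
Lemma count_tail_le (lam c : R) T : 0 <= lam ->
  (P [set w | ((count_trials I T w)%:R <= c)%R] <=
   (expR (lam * c) * (1 - p * (1 - expR (- lam))) ^+ T)%:E)%E.
Proof.
move=> lam0; rewrite PrE ?lee_fin; last exact: measurable_count_le.
have -> : Pr [set w | (count_trials I T w)%:R <= c] =
    \sum_(j < T.+1) Pr (if j%:R <= c then C T j else set0).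
  have mCj (j : nat) : measurable (if j%:R <= c then C T j else set0).
    by case: ifP.
  apply: EFin_inj; rewrite -PrE; last exact: measurable_count_le.
  rewrite count_le_bigcup (@measure_bigsetU _ _ _ P
    (fun j : nat => if j%:R <= c then C T j else set0)) //.
    by rewrite -sumEFin; apply: eq_bigr => j _; exact: PrE.
  apply/trivIsetP => i j _ _ /eqP ij; apply/seteqP; split=> w //=.
  by case: ifP => // _ []; case: ifP => // _; rewrite /C /= => -> /ij.
rewrite -ler_pdivrMl ?expR_gt0 //.
apply: (le_trans _ (count_moment_le T _)); last first.
  by rewrite expR_ge0 -expR0 ler_expR oppr_le0.
rewrite mulr_sumr; apply: ler_sum => j _; rewrite -expRN -expRM_natl.
have Pr0 : 0 <= Pr (C T j) by rewrite /Pr fine_ge0.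
case: ifPn => jc.
  rewrite ler_wpM2r // ler_expR.
  have : lam * j%:R <= lam * c by rewrite ler_wpM2l.
  by rewrite mulrN mulrC lerN2.
by rewrite /Pr measure0 mulr0 mulr_ge0 // expR_ge0.
Qed.

End AdaptedTrials.

(** * Measurability with respect to the past of the oracles *)

Section History.
Context {R : realType} {d d0 d1 : measure_display} {Omega : measurableType d}.
Context {Xi0 : measurableType d0} {Xi1 : measurableType d1}.
Variable xi : oracle_noise Omega Xi0 Xi1.

Lemma history_sigma_algebra k : sigma_algebra setT (history xi k).
Proof. exact: smallest_sigma_algebra. Qed.

Lemma history_mono k : history xi k `<=` history xi k.+1.
Proof.
by apply: sub_sigma_algebra2; apply: bigcup_subset => j /= /ltnW; rewrite ltnS.
Qed.

Lemma history_measurable k : noise_measurable xi ->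
  history xi k `<=` @measurable _ Omega.
Proof.
move=> mxi; apply: smallest_sub; first exact: sigma_algebra_measurable.
have pull d' (Y : measurableType d') (h : Omega -> Y) : measurable_fun setT h ->
    preimage_set_system setT h measurable `<=` @measurable _ Omega.
  by move=> mh _ [B mB <-]; exact: mh.
move=> A [j _ [[]|]]; have [m0 m0p m1] := mxi j; exact: pull.
Qed.

Lemma measurable_wrt_fun k (h : Omega -> R) : measurable_wrt (history xi k) h ->
  measurable_fun (T := g_sigma_algebraType (history xi k)) setT h.
Proof.
move=> hh _ B mB; rewrite measurable_g_measurableTypeE.
  by apply: hh; exists B.
exact: history_sigma_algebra.
Qed.

Lemma measurable_wrt_ambient k (h : Omega -> R) : noise_measurable xi ->
  measurable_wrt (history xi k) h -> measurable_fun setT h.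
Proof.
move=> mxi hh _ B mB; apply: (@history_measurable k) => //.
by apply: hh; exists B.
Qed.

Lemma measurable_wrtS k (h : Omega -> R) :
  measurable_wrt (history xi k) h -> measurable_wrt (history xi k.+1) h.
Proof. by move=> hh A /hh; exact: history_mono. Qed.

End History.

Section Reliability.
Context {R : realType} {n : nat} {d d0 d1 : measure_display}.
Context {Omega : measurableType d}.
Context {Xi0 : measurableType d0} {Xi1 : measurableType d1}.
Variables (phi : 'cV[R]_n -> R) (xi : oracle_noise Omega Xi0 Xi1).
Hypothesis cont_grad : forall x : 'cV[R]_n, {for x, continuous (gradient phi)}.

Lemma measurable_gradient_comp d' (T : measurableType d')
    (X : T -> 'cV[R]_n) i :
  (forall j, measurable_fun setT (fun w => X w j 0)) ->
  measurable_fun setT (fun w => gradient phi (X w) i 0).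
Proof.
move=> mX.
apply: (measurable_continuous_comp (u := fun x => gradient phi x i 0)) => // x.
apply: (@continuous_comp _ _ _ (gradient phi) (fun M : 'cV[R]_n => M i 0)).
  exact: cont_grad.
exact: coord_continuous.
Qed.

Lemma reliable_adapted (epsg keg : R) k (X G : Omega -> 'cV[R]_n)
    (Delta : Omega -> R) :
  vmeasurable_wrt (history xi k) X -> measurable_wrt (history xi k) Delta ->
  vmeasurable_wrt (history xi k.+1) G ->
  history xi k.+1
    [set w | enorm (G w - gradient phi (X w)) <= keg * Delta w + epsg].
Proof.
move=> mX mDelta mG.
rewrite -(measurable_g_measurableTypeE (history_sigma_algebra xi k.+1)).
rewrite -[X in measurable X]setTI; apply: measurable_fun_le => //.
  apply: measurable_enorm => i.
  rewrite (_ : (fun w => (G w - gradient phi (X w)) i 0)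
    = (fun w => G w i 0 - gradient phi (X w) i 0)); last first.
    by apply/funext => w; rewrite !mxE.
  apply: measurable_funB; first exact: measurable_wrt_fun.
  apply: measurable_gradient_comp => j; apply: measurable_wrt_fun.
  exact: measurable_wrtS.
apply: measurable_funD => //; apply: measurable_funM => //.
by apply: measurable_wrt_fun; exact: measurable_wrtS.
Qed.

End Reliability.

(** * The complexity bound *)

Theorem theorem4p11 (R : realType) (n : nat) (phi : 'cV[R]_n -> R)
    (L1 phihat : R) (a : tr_params R) (x0 : 'cV[R]_n)
    (delta0 p1 epsf epsg keg : R)
    (d d0 d1 : measure_display) (Omega : measurableType d)
    (Xi0 : measurableType d0) (Xi1 : measurableType d1)
    (P : probability Omega R) (xi : oracle_noise Omega Xi0 Xi1)
    (f : 'cV[R]_n -> Xi0 -> R) (g : R -> R -> 'cV[R]_n -> Xi1 -> 'cV[R]_n)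
    (X : nat -> Omega -> 'cV[R]_n) (Delta : nat -> Omega -> R)
    (G : nat -> Omega -> 'cV[R]_n) (H : nat -> Omega -> 'M[R]_n)
    (S : nat -> Omega -> 'cV[R]_n)
    (hphi : continuously_differentiable phi)
    (hL1 : 0 <= L1) (hlip : lipschitz_gradient phi L1)
    (hbelow : forall x, phihat <= phi x)
    (ha : tr_params_ok a) (hdelta0 : 0 < delta0)
    (hp1 : 1 / 2 < p1 <= 1)
    (hepsf : 0 <= epsf) (hepsg : 0 <= epsg) (hkeg : 0 <= keg)
    (hf : zeroth_order_oracle phi epsf f)
    (hproc : tr_process a phi x0 delta0 p1 epsg keg f g P xi X Delta G H S)
    (hr : 2 * epsf <= relax a)
    (eps : R)
    (heps : Num.sqrt ((4 * epsf + 2 * relax a) /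
              (C3 a * gamma a ^+ 2 * C1 a L1 keg ^+ 2 * (2 * p1 - 1)))
            + C2 a L1 keg / C1 a L1 keg * epsg < eps) :
  let D := C1 a L1 keg * eps - C2 a L1 keg * epsg in
  let K := C3 a * gamma a ^+ 2 * D ^+ 2 in
  forall phat : R,
    1 / 2 + (2 * epsf + relax a) / K < phat <= p1 ->
  forall T : nat, (0 < T)%N ->
    (phat - 1 / 2 - (2 * epsf + relax a) / K)^-1 *
      ((phi x0 - phihat) / K
       + 1 / 2 * logb (gamma a)
           (radius_ratio delta0 D
              (C1 a L1 keg * enorm (gradient phi x0) - C2 a L1 keg * epsg))
       + 1 / 2) <= T%:R ->
  ((1 - expR (- ((1 - phat / p1) ^+ 2 / 2 * T%:R)))%:E <=
   P [set w | (\big[Num.min/enorm (gradient phi (X 0%N w))]_(0 <= k < T)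
                enorm (gradient phi (X k w)) <= eps)%R])%E.
Proof.
move=> D K phat /andP[phat_gt phat_le] T T0 T_ge.
have [p1_gt p1_le] := andP hp1.
have [_ _ g01 r0 _] := ha; have [g0 _] := andP g01.
have [dphi cont_grad] := hphi.
have C1_0 : 0 < C1 a L1 keg by exact: C1_gt0.
have D0 : 0 < D.
  have : C2 a L1 keg / C1 a L1 keg * epsg < eps.
    by apply: le_lt_trans heps; rewrite lerDr sqrtr_ge0.
  by rewrite mulrAC ltr_pdivrMr // (mulrC eps) /D subr_gt0.
have K0 : 0 < K.
  by rewrite /K mulr_gt0 ?exprn_gt0 // mulr_gt0 ?exprn_gt0 // C3_gt0.
set c := (2 * epsf + relax a) / K in phat_gt T_ge.
have c0 : 0 <= c by rewrite divr_ge0 ?(ltW K0) // addr_ge0 ?mulr_ge0 // ltW.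
pose I k w := reliable phi epsg keg (X ^~ w) (Delta ^~ w) (G ^~ w) k.
have I_adapted k : history xi k.+1 [set w | I k w].
  apply: reliable_adapted => //.
  - exact: (trp_X_meas hproc).
  - exact: (trp_Delta_meas hproc).
  - exact: (trp_G_meas hproc).
have F_meas k : history xi k `<=` @measurable _ Omega.
  exact: history_measurable (trp_noise hproc).
have mX k i : measurable_fun setT (fun w => X k w i 0).
  apply: (measurable_wrt_ambient (trp_noise hproc)).
  exact: (trp_X_meas hproc).
set good := [set w | _].
have goodE : good =
    \bigcup_(k in `I_T) [set w | enorm (gradient phi (X k w)) <= eps].
  apply/seteqP; split=> w; rewrite /good /= big_mkord.
    move=> /bigmin_leP[X0|[i _ Xi]]; first by exists 0%N.
    by exists i => /=.
  move=> [k /= kT Xk]; apply/bigmin_leP; right.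
  by exists (Ordinal kT).
have m_good : measurable good.
  rewrite goodE; apply: bigcup_measurable => k _.
  rewrite -[X in measurable X]setTI; apply: measurable_fun_le => //.
  by apply: measurable_enorm => i; exact: measurable_gradient_comp.
(* Off the event all gradients are large, so reliable iterations are rare. *)
have few w : ~ good w -> (count_trials I T w)%:R <= phat * T%:R.
  move=> bad.
  have grad_gt k : (k < T)%N -> eps < enorm (gradient phi (X k w)).
    move=> kT; rewrite ltNge; apply/negP => Xk; apply: bad.
    by rewrite goodE; exists k.
  have DV k : (k < T)%N ->
      D < C1 a L1 keg * enorm (gradient phi (X k w)) - C2 a L1 keg * epsg.
    by move=> kT; rewrite /D ltrD2r ltr_pM2l // grad_gt.
  have run := trp_run hproc w.
  have := reliable_count_le ha hL1 hepsf hepsg hkeg dphi hlip hr run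
    (fun k => hf (X k w) _) (fun k => hf (X k w + S k w) _) hdelta0 D0
    (erefl K) hbelow DV.
  rewrite -natr_sum -/c -/(count_trials I T w) => count_le.
  have log_le := @normr_log_le R (gamma a) D _ delta0 g01 hdelta0 _.
  have := log_le (C1 a L1 keg * enorm (gradient phi x0) - C2 a L1 keg * epsg).
  rewrite -[in enorm (gradient phi x0)](tr_x0 run) D0 DV // (tr_x0 run).
  move=> /(_ isT) {}log_le; move: T_ge.
  rewrite ler_pdivrMl; last by move: phat_gt; lra.
  move: (logb _ _) log_le count_le => l; move: (logb _ _) => l'.
  move: (phi x0 - phihat) => e; move: (_%:R) (T%:R) => N T'.
  lra.
pose t := 1 - phat / p1.
have p10 : 0 < p1 by lra.
have t01 : 0 <= t <= 1.
  rewrite /t subr_ge0 ler_pdivrMr // mul1r phat_le /= gerBl.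
  by rewrite divr_ge0 ?(ltW p10) //; lra.
have phatE : phat = p1 * (1 - t) by rewrite /t; field; rewrite gt_eqF.
have hist_sigma k := history_sigma_algebra xi k.
have hist_mono k := @history_mono _ _ _ _ _ _ xi k.
have m_tail : measurable [set w | (count_trials I T w)%:R <= phat * T%:R].
  exact: (measurable_count_le hist_sigma hist_mono F_meas I_adapted).
have tail : (P (~` good) <= (expR (- (t ^+ 2 / 2 * T%:R)))%:E)%E.
  apply: (@le_trans _ _ (P [set w | (count_trials I T w)%:R <= phat * T%:R])).
    by apply: le_measure => //; rewrite inE //; exact: measurableC.
  have := count_tail_le hist_sigma hist_mono F_meas I_adapted
    (trp_reliable hproc) (ltW p10) p1_le (phat * T%:R) T (lam := 2 * t).
  rewrite mulr_ge0 ?(andP t01).1 // => /(_ isT) /le_trans; apply.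
  rewrite lee_fin phatE; apply: bernoulli_expR_le_pow => //.
  by rewrite (ltW p1_gt).
rewrite -(setCK good) probability_setC; last exact: measurableC.
by rewrite EFinB leeB.
Qed.
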